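(* Let $\rho:\Gamma\to G$ be a $(P^+,P^-)$-Anosov representation, let $M:=\Omega_\rho$ be its domain of discontinuity, and for $g\in\rho(\Gamma)$ let $E^g=g^*TM$. For each $k\in\{0,1,\dots,\dim M\}$, $\rho(\Gamma)$ acts properly discontinuously on the disjoint union $\coprod_{g\in\rho(\Gamma)}\Omega^k(M;\mathrm{End}(E^g))$.
   Context: Anosov representations. $\Gamma$ is a finitely generated word hyperbolic group with boundary $\partial_\infty\Gamma$, and $\partial_\infty\Gamma^{(2)}=\partial_\infty\Gamma\times\partial_\infty\Gamma\setminus\{(t,t)\}$. $G$ is a semisimple Lie group, $(P^+,P^-)$ a pair of opposite parabolic subgroups, $\mathcal{F}^\pm=G/P^\pm$. A pair in $\mathcal{F}^+\times\mathcal{F}^-$ is transverse if it lies in the unique open $G$-orbit of the diagonal action (this orbit is $\cong G/(P^+\cap P^-)$). $\hat\Gamma$ is the (essentially unique) proper hyperbolic metric space with an action of $\Gamma\times(\mathbb{R}\rtimes\mathbb{Z}/2\mathbb{Z})$ such that $\Gamma\times\mathbb{Z}/2\mathbb{Z}$ acts isometrically, every orbit map $\Gamma\to\hat\Gamma$ is a quasi-isometry, the $\mathbb{R}$-action $\phi_t$ is free with quasi-isometrically embedded orbits, and the induced map $(\tau^+,\tau^-):\hat\Gamma/\mathbb{R}\to\partial_\infty\Gamma^{(2)}$ (endpoints of orbits) is a homeomorphism. A representation $\rho:\Gamma\to G$ is $(P^+,P^-)$-Anosov if there are continuous $\rho$-equivariant maps $\xi^\pm:\partial_\infty\Gamma\to\mathcal{F}^\pm$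 such that (1) $(\xi^+(t^+),\xi^-(t^-))$ is transverse for all $(t^+,t^-)\in\partial_\infty\Gamma^{(2)}$; (2) for one (hence any) continuous equivariant family of norms $\|\cdot\|_{\hat m}$, $\hat m\in\hat\Gamma$, on $T_{\xi^+(\tau^+(\hat m))}\mathcal{F}^+$ (resp. $T_{\xi^-(\tau^-(\hat m))}\mathcal{F}^-$) there are $A,a>0$ with $\|e\|_{\phi_{-t}(\hat m)}\le Ae^{-at}\|e\|_{\hat m}$ (resp. $\|e\|_{\phi_t(\hat m)}\le Ae^{-at}\|e\|_{\hat m}$) for all $t\ge0$, $\hat m$, $e$. Domain of discontinuity. $\mathcal{X}=G/H$ with $H$ a parabolic or a symmetric subgroup of $G$. $M=\Omega_\rho\subset\mathcal{X}$ is a domain of discontinuity for $\rho$: an open $\rho(\Gamma)$-invariant subset such that for every compact $K\subset\Omega_\rho$ the set $\{\gamma\in\Gamma:\rho(\gamma)K\cap K\ne\emptyset\}$ is finite. An action of $\rho(\Gamma)$ on a topological space $X$ is called properly discontinuous if for every compact $K\subset X$ the set $\{\gamma\in\Gamma:\rho(\gamma)K\cap K\neq\emptyset\}$ is finite. Bundles and actions. Each $g\in\rho(\Gamma)$ acts on $M$ as a diffeomorphism; $E^g=g^*TM=\{(m,x)\in M\times TM: x\in T_{gm}M\}$. For $g,g'\in\rho(\Gamma)$ there is a vector bundle isomorphism $g:E^{g'}\to E^{gg'}$ over $\mathrm{id}_M$, given on the fibre over $m$ by $dg|_{g'm}:T_{g'm}M\to T_{gg'm}M$; it induces $g:\mathrm{End}(E^{g'})\to\mathrm{End}(E^{gg'})$,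 $v\mapsto dg|_{g'm}\circ v\circ(dg|_{g'm})^{-1}$ on the fibre over $m$. $\Omega^k(M;\mathrm{End}(E^g))$ is the space of $k$-forms with coefficients in $\mathrm{End}(E^g)$, and $g:\Omega^k(M;\mathrm{End}(E^{g'}))\to\Omega^k(M;\mathrm{End}(E^{gg'}))$ is $g(\sum\alpha_i\sigma_i)=\sum\alpha_i\,g(\sigma_i)$ for $\alpha_i\in\Omega^k(M)$, $\sigma_i\in\Omega^0(M;\mathrm{End}(E^{g'}))$. This gives the action on the disjoint union. Topology. $\Omega^k(M;\mathrm{End}(E^g))$ has the topology of pointwise convergence, i.e. the subspace topology from the product $\prod_{m\in M}(\bigwedge^kT^*M\otimes\mathrm{End}(E^g))$ of copies of the total space of the bundle (a section is identified with the family of its values); the disjoint union has the disjoint union topology. *)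

(* Defs.v *)
From HB Require Import structures.
From mathcomp Require Import all_boot all_order all_algebra.
From mathcomp Require Import all_classical all_reals all_analysis.
Import Order.TTheory GRing.Theory Num.Theory.
Import numFieldNormedType.Exports.

Set Implicit Arguments.
Unset Strict Implicit.
Unset Printing Implicit Defensive.

Local Open Scope classical_set_scope.
Local Open Scope ring_scope.

Section smooth_at.
Context {R : realType} {V W : normedModType R}.

(* [C_at k f a]: f is of class C^k in a neighbourhood of a. *)
Fixpoint C_at (k : nat) (f : V -> W) (a : V) : Prop :=
  match k with
  | 0 => \forall x \near a, {for x, continuous f}
  | k'.+1 => (\forall x \near a, differentiable f x) /\
             forall v : V, C_at k' (fun x => 'd f x v) a
  end.

Definition smooth_at (f : V -> W) (a : V) := forall k, C_at k f a.

End smooth_at.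

(* An atlas is given as a family of charts indexed by the points of M, the    *)
(* chart of index x being defined at x.  The tangent space at x is then       *)
(* 'rV[R]_n, a tangent vector being identified with its coordinates in the    *)
(* chart of index x.  [chart_inv x] is only meaningful on the image of        *)
(* [chart x], which is open.                                                  *)
HB.mixin Record isSmoothManifold (R : realType) (n : nat) M & Topological M := {
  chart_dom : M -> set M;
  chart : M -> M -> 'rV[R]_n;
  chart_inv : M -> 'rV[R]_n -> M;
  chart_dom_open : forall x, open (chart_dom x);
  chart_dom_self : forall x, chart_dom x x;
  chart_image_open : forall x, open (chart x @` chart_dom x);
  chartK : forall x y, chart_dom x y -> chart_inv x (chart x y) = y;
  chart_continuous : forall x y, chart_dom x y -> {for y, continuous (chart x)};
  chart_inv_continuous : forall x y, chart_dom x y ->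
    {for chart x y, continuous (chart_inv x)};
  chart_smooth : forall x y z, chart_dom x z -> chart_dom y z ->
    smooth_at (chart y \o chart_inv x) (chart x z);
  manifold_hausdorff : hausdorff_space M;
  manifold_second_countable : @second_countable M;
}.

#[short(type="smoothManifoldType")]
HB.structure Definition SmoothManifold (R : realType) (n : nat) :=
  { M of Topological M & isSmoothManifold R n M }.

Section smooth_maps.
Context {R : realType} {m n p : nat}.
Context {M : smoothManifoldType R m} {N : smoothManifoldType R n}.
Context {L : smoothManifoldType R p}.

Definition smooth_map (f : M -> N) := forall x,
  {for x, continuous f} /\
  smooth_at (chart (f x) \o f \o chart_inv x) (chart x x).

Definition smooth_map2 (f : M -> N -> L) := forall x y,
  {for (x, y), continuous (fun q : M * N => f q.1 q.2)} /\
  smooth_at (fun v : 'rV[R]_(m + n) =>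
      chart (f x y) (f (chart_inv x (lsubmx v)) (chart_inv y (rsubmx v))))
    (row_mx (chart x x) (chart y y)).

(* Matrix of the differential T_x M -> T_y N of f at x, where y = f x.        *)
(* Tangent vectors are row vectors and matrices act on the right, so that     *)
(* the matrix of a composite is the product in reading order.                 *)
Definition tangent_mx (f : M -> N) (x : M) (y : N) : 'M[R]_(m, n) :=
  'J (chart y \o f \o chart_inv x) (chart x x).

(* Change of coordinates on T_z M, from the chart of index x to that of index y. *)
Definition tcoord (x y z : M) : 'M[R]_m :=
  'J (chart y \o chart_inv x) (chart x z).

End smooth_maps.

HB.mixin Record isLieGroup (R : realType) (n : nat) G
    & Group G & SmoothManifold R n G := {
  lie_mul_smooth : smooth_map2 (fun x y : G => (x * y)%g);
  lie_inv_smooth : smooth_map (fun x : G => (x^-1)%g);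
}.

#[short(type="lieGroupType")]
HB.structure Definition LieGroup (R : realType) (n : nat) :=
  { G of Group G & SmoothManifold R n G & isLieGroup R n G }.

Section lie_theory.
Context {R : realType} {n : nat} {G : lieGroupType R n}.

Definition Ad (g : G) : 'M[R]_n :=
  tangent_mx (fun x : G => (g * x * g^-1)%g) (1%g : G) (1%g : G).

(* [X, Y] is the derivative at 1 of g |-> Ad g Y in the direction X. *)
Definition lie_bracket (X Y : 'rV[R]_n) : 'rV[R]_n :=
  'D_X (fun v => Y *m Ad (chart_inv (1%g : G) v)) (chart (1%g : G) (1%g : G)).

(* No nonzero abelian ideal. *)
Definition semisimple := forall I : {vspace 'rV[R]_n},
  (forall X Y, Y \in I -> lie_bracket X Y \in I) ->
  (forall X Y, X \in I -> Y \in I -> lie_bracket X Y = 0) ->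
  I = 0%VS.

Definition normalizer (p : 'M[R]_n) : set G :=
  [set g | (p *m Ad g == p)%MS].

(* Let X be an element of the Lie algebra such that ad X is diagonalizable    *)
(* over R, with eigenbasis the rows of E and eigenvalues l.  The sum of the   *)
(* eigenspaces of nonnegative (resp. nonpositive) eigenvalue is a parabolic   *)
(* subalgebra, these two subalgebras are opposite, and every pair of opposite *)
(* parabolic subalgebras is of this form.  A parabolic subgroup is the        *)
(* normalizer of a parabolic subalgebra.                                      *)
Definition opposite_parabolics (Pp Pm : set G) :=
  exists (X : 'rV[R]_n) (E : 'M[R]_n) (l : 'I_n -> R),
  [/\ E \in unitmx,
      forall i, lie_bracket X (row i E) = l i *: row i E,
      Pp = normalizer (\sum_(i < n | (0 <= l i)%R) <<row i E>>)%MS &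
      Pm = normalizer (\sum_(i < n | (l i <= 0)%R) <<row i E>>)%MS].

Definition parabolic (H : set G) := exists Q, opposite_parabolics H Q.

Definition subgroup (H : set G) :=
  [/\ H 1%g, (forall x y, H x -> H y -> H (x * y)%g) &
      forall x, H x -> H (x^-1)%g].

Definition symmetric_subgroup (H : set G) :=
  subgroup H /\
  exists s : {multiplicative G -> G},
  let Fix := [set g | s g = g] in
  [/\ smooth_map s, involutive s,
      connected_component Fix 1%g `<=` H & H `<=` Fix].

Section action.
Context {d : nat} {X : smoothManifoldType R d}.

(* X is G/H, with base point x0: a smooth transitive action of a second       *)
(* countable Lie group identifies X with the quotient by the stabilizer.      *)
Definition homogeneous_space (H : set G) (act : G -> X -> X) (x0 : X) :=
  [/\ smooth_map2 act,
      forall x, act 1%g x = x,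
      forall g h x, act (g * h)%g x = act g (act h x),
      forall x, exists g, x = act g x0 &
      [set g | act g x0 = x0] = H].

End action.

Definition transverse {p q : nat}
    {Fp : smoothManifoldType R p} {Fm : smoothManifoldType R q}
    (actp : G -> Fp -> Fp) (actm : G -> Fm -> Fm) (x : Fp) (y : Fm) :=
  open [set (actp g x, actm g y) | g in [set: G]].

End lie_theory.

Arguments semisimple {R n} G.

Section gromov.
Context {R : realType} {T : Type}.
Variable d : T -> T -> R.

Definition gromov_product (o x y : T) : R := (d x o + d y o - d x y) / 2.

Definition hyperbolic := exists delta : R, forall o x y z,
  Num.min (gromov_product o x y) (gromov_product o y z) - delta <=
  gromov_product o x z.

Definition gromov_div (u v : nat -> T) := forall (o : T) (r : R),
  exists N, forall i j, (N <= i)%N -> (N <= j)%N ->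
    r <= gromov_product o (u i) (v j).

Definition boundary_class (u : nat -> T) : set (nat -> T) :=
  [set v | gromov_div v v /\ gromov_div u v].

Definition boundary : Type :=
  {c : set (nat -> T) | exists2 u, gromov_div u u & c = boundary_class u}.

HB.instance Definition _ := gen_eqMixin boundary.
HB.instance Definition _ := gen_choiceMixin boundary.

(* The sets [boundary_nbhd o r p], for r in R, form a basis of neighbourhoods of p. *)
Definition boundary_nbhd (o : T) (r : R) (p : boundary) : set boundary :=
  [set q | exists u v, [/\ sval p u, sval q v &
    exists N, forall i j, (N <= i)%N -> (N <= j)%N ->
      r <= gromov_product o (u i) (v j)]].

Definition boundary_open (U : set boundary) :=
  forall p, U p -> forall o, exists r, boundary_nbhd o r p `<=` U.

Lemma boundary_openT : boundary_open setT.
Proof. by move=> p _ o; exists 0. Qed.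

Lemma boundary_nbhdS o r s p :
  r <= s -> boundary_nbhd o s p `<=` boundary_nbhd o r p.
Proof.
move=> rs q [u [v [pu qv [N HN]]]]; exists u, v; split=> //.
by exists N => i j Ni Nj; exact: le_trans rs (HN i j Ni Nj).
Qed.

Lemma boundary_openI : setI_closed boundary_open.
Proof.
move=> A B oA oB p [Ap Bp] o.
have [r rA] := oA p Ap o; have [s sB] := oB p Bp o.
exists (Num.max r s) => q pq; split.
  by apply: rA; apply: boundary_nbhdS pq; rewrite le_max lexx.
by apply: sB; apply: boundary_nbhdS pq; rewrite le_max lexx orbT.
Qed.

Lemma boundary_open_bigU (I : Type) (f : I -> set boundary) :
  (forall i, boundary_open (f i)) -> boundary_open (\bigcup_i f i).
Proof.
move=> of_ p [i _ fip] o; have [r rf] := of_ i p fip o.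
by exists r => q /rf fq; exists i.
Qed.

HB.instance Definition _ := isOpenTopological.Build boundary
  boundary_openT boundary_openI boundary_open_bigU.

Definition boundary2 : set (boundary * boundary) := [set t | t.1 <> t.2].

End gromov.

Definition quasi_isometric_embedding {R : realType} {A B : Type}
    (dA : A -> A -> R) (dB : B -> B -> R) (f : A -> B) :=
  exists L C : R, 0 < L /\ forall x y,
    L^-1 * dA x y - C <= dB (f x) (f y) <= L * dA x y + C.

Definition quasi_isometry {R : realType} {A B : Type}
    (dA : A -> A -> R) (dB : B -> B -> R) (f : A -> B) :=
  quasi_isometric_embedding dA dB f /\
  exists C : R, forall y, exists x, dB (f x) y <= C.

Section hyperbolic_group.
Context {R : realType} {Gamma : groupType}.
Variable S : seq Gamma.

Definition word (n : nat) (x : Gamma) :=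
  exists w : seq Gamma, [/\ size w = n,
    all (fun s => (s \in S) || (s^-1 \in S)%g) w &
    x = \big[*%g/1%g]_(s <- w) s].

Definition generates := forall x, exists n, word n x.

Definition word_dist (x y : Gamma) : R :=
  inf [set n%:R | n in [set n | word n (x^-1 * y)%g]].

Definition word_hyperbolic := generates /\ hyperbolic word_dist.

Lemma word_distM g x y : word_dist (g * x)%g (g * y)%g = word_dist x y.
Proof. by rewrite /word_dist invgM -mulgA mulKg. Qed.

Lemma gromov_productM g o x y :
  gromov_product word_dist (g * o)%g (g * x)%g (g * y)%g =
  gromov_product word_dist o x y.
Proof. by rewrite /gromov_product !word_distM. Qed.

Lemma gromov_divM g u v : gromov_div word_dist u v ->
  gromov_div word_dist (fun i => (g * u i)%g) (fun i => (g * v i)%g).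
Proof.
move=> uv o r; have [N HN] := uv (g^-1 * o)%g r; exists N => i j Ni Nj.
by have := HN i j Ni Nj; rewrite -(gromov_productM g) mulVKg.
Qed.

Lemma boundary_action_subproof g (p : boundary word_dist) :
  exists2 u, gromov_div word_dist u u &
  [set (fun i => (g * v i)%g) | v in sval p] = boundary_class word_dist u.
Proof.
case: p => c /= [u uu ->]; exists (fun i => (g * u i)%g).
  exact: gromov_divM.
apply/seteqP; split=> [_ [v [vv uv] <-]|v [vv uv]].
  by split; exact: gromov_divM.
exists (fun i => (g^-1 * v i)%g); last by apply/funext => i; rewrite mulVKg.
split; first exact: gromov_divM.
have := gromov_divM (g^-1)%g uv.
by under [X in gromov_div _ X _]eq_fun do rewrite mulKg.
Qed.

Definition boundary_action (g : Gamma) (p : boundary word_dist) :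
  boundary word_dist := exist _ _ (boundary_action_subproof g p).

(* The space hat Gamma, with the action of Gamma x (R x| Z/2Z) given by the   *)
(* commuting actions [fs_act] of Gamma and [fs_flow] of R together with the   *)
(* involution [fs_flip], and the endpoint map [fs_tau] = (tau^+, tau^-).      *)
Record flow_space := FlowSpace {
  fs_space :> metricType R;
  fs_act : Gamma -> fs_space -> fs_space;
  fs_flow : R -> fs_space -> fs_space;
  fs_flip : fs_space -> fs_space;
  fs_tau : fs_space -> set_type (boundary2 (d := word_dist));
  fs_proper : forall (x : fs_space) (r : R),
    compact [set y : fs_space | mdist x y <= r];
  fs_hyperbolic : hyperbolic (@mdist R fs_space);
  fs_act1 : forall x, fs_act 1%g x = x;
  fs_actM : forall g h x, fs_act (g * h)%g x = fs_act g (fs_act h x);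
  fs_flow0 : forall x, fs_flow 0 x = x;
  fs_flowD : forall s t x, fs_flow (s + t) x = fs_flow s (fs_flow t x);
  fs_flow_continuous : continuous (fun q : R * fs_space => fs_flow q.1 q.2);
  fs_flipK : involutive fs_flip;
  fs_act_flow : forall g t x, fs_act g (fs_flow t x) = fs_flow t (fs_act g x);
  fs_act_flip : forall g x, fs_act g (fs_flip x) = fs_flip (fs_act g x);
  fs_flip_flow : forall t x, fs_flip (fs_flow t x) = fs_flow (- t) (fs_flip x);
  fs_act_isometry : forall g (x y : fs_space),
    mdist (fs_act g x) (fs_act g y) = mdist x y;
  fs_flip_isometry : forall x y : fs_space,
    mdist (fs_flip x) (fs_flip y) = mdist x y;
  fs_orbit_map : forall x : fs_space,
    quasi_isometry word_dist (@mdist R fs_space) (fun g => fs_act g x);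
  fs_flow_free : forall t x, fs_flow t x = x -> t = 0;
  fs_flow_orbit : forall x : fs_space,
    quasi_isometric_embedding (fun s t : R => `|s - t|) (@mdist R fs_space)
      (fun t => fs_flow t x);
  (* tau^+ and tau^- are the forward and backward endpoints of flow lines,    *)
  (* the boundary of Gamma being identified with that of hat Gamma through    *)
  (* the orbit maps.                                                          *)
  fs_tau_forward : forall (m o : fs_space) u, sval (val (fs_tau m)).1 u ->
    gromov_div (@mdist R fs_space)
      (fun i => fs_act (u i) o) (fun j => fs_flow j%:R m);
  fs_tau_backward : forall (m o : fs_space) u, sval (val (fs_tau m)).2 u ->
    gromov_div (@mdist R fs_space)
      (fun i => fs_act (u i) o) (fun j => fs_flow (- j%:R) m);
  (* fs_tau induces a homeomorphism from the quotient by the flow. *)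
  fs_tau_eq : forall x y, fs_tau x = fs_tau y <-> exists t, y = fs_flow t x;
  fs_tau_surj : forall t, exists x, fs_tau x = t;
  fs_tau_open : forall U, open U <-> open (fs_tau @^-1` U);
}.

Definition tau_plus (F : flow_space) (m : F) := (val (fs_tau m)).1.
Definition tau_minus (F : flow_space) (m : F) := (val (fs_tau m)).2.

End hyperbolic_group.

Definition is_norm {R : realType} {V : lmodType R} (N : V -> R) :=
  [/\ forall e, N e = 0 -> e = 0,
      forall a e, N (a *: e) = `|a| * N e &
      forall e f, N (e + f) <= N e + N f].

Section anosov.
Context {R : realType} {Gamma : groupType} {S : seq Gamma}.
Context (hGamma : @flow_space R Gamma S).
Context {n : nat} {G : lieGroupType R n} (rho : {multiplicative Gamma -> G}).

(* Continuous rho-equivariant families of norms N m on T_(f m) F.  The        *)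
(* continuity at m0 is expressed in the chart of F of index f m0.             *)
Definition equivariant_norms {p : nat} {F : smoothManifoldType R p}
    (act : G -> F -> F) (f : hGamma -> F) (N : hGamma -> 'rV[R]_p -> R) :=
  [/\ forall m, is_norm (N m),
      forall m0 v, {for (m0, v), continuous (fun q : hGamma * 'rV[R]_p =>
        N q.1 (q.2 *m tcoord (f m0) (f q.1) (f q.1)))} &
      forall g m e,
        N (fs_act g m) (e *m tangent_mx (act (rho g)) (f m) (f (fs_act g m))) =
        N m e].

Definition anosov {p q : nat}
    {Fp : smoothManifoldType R p} {Fm : smoothManifoldType R q}
    (actp : G -> Fp -> Fp) (actm : G -> Fm -> Fm) :=
  exists (xip : boundary (@word_dist R Gamma S) -> Fp)
         (xim : boundary (@word_dist R Gamma S) -> Fm),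
  [/\ continuous xip /\ continuous xim,
      (forall g t, xip (boundary_action g t) = actp (rho g) (xip t)) /\
      (forall g t, xim (boundary_action g t) = actm (rho g) (xim t)),
      forall t t', boundary2 (t, t') ->
        transverse actp actm (xip t) (xim t'),
      exists N, equivariant_norms actp (fun m => xip (tau_plus m)) N /\
        exists A a : R, [/\ 0 < A, 0 < a & forall t m e, 0 <= t ->
          N (fs_flow (- t) m) e <= A * expR (- (a * t)) * N m e] &
      exists N, equivariant_norms actm (fun m => xim (tau_minus m)) N /\
        exists A a : R, [/\ 0 < A, 0 < a & forall t m e, 0 <= t ->
          N (fs_flow t m) e <= A * expR (- (a * t)) * N m e]].

End anosov.

(* [act] restricts to a properly discontinuous action on D.  K is a compact   *)
(* subset of the subspace D, which is the same as a compact set K `<=` D.     *)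
Definition acts_properly_discontinuously {Gamma : groupType}
    {X : topologicalType} (act : Gamma -> X -> X) (D : set X) :=
  [/\ forall g x, D x -> D (act g x),
      forall x, D x -> act 1%g x = x,
      forall g h x, D x -> act (g * h)%g x = act g (act h x) &
      forall K, K `<=` D -> compact K ->
        finite_set [set g | (act g @` K) `&` K !=set0]].

(* Omega plays the role of the manifold M, hence is nonempty. *)
Definition domain_of_discontinuity {Gamma : groupType}
    {X : topologicalType} (act : Gamma -> X -> X) (Omega : set X) :=
  [/\ Omega !=set0, open Omega & acts_properly_discontinuously act Omega].

Section multilinear.
Context {R : realType} {k d : nat}.

(* The k arguments of a k-linear map are the rows of a matrix. *)
Definition multilinear (f : 'M[R]_(k, d) -> 'M[R]_d) :=
  forall (i : 'I_k) (A B C : 'M[R]_(k, d)) (b c : R),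
    row i A = b *: row i B + c *: row i C ->
    row' i B = row' i A -> row' i C = row' i A ->
    f A = b *: f B + c *: f C.

Definition alternate (f : 'M[R]_(k, d) -> 'M[R]_d) :=
  forall (i j : 'I_k) (A : 'M[R]_(k, d)), i != j -> row i A = row j A -> f A = 0.

End multilinear.

(* Alternating k-linear maps from R^d to End(R^d), i.e. the fibre of          *)
(* Lambda^k T^*M (x) End(E^g).                                                *)
Definition alt_maps (R : realType) (k d : nat) :
    set {ptws 'M[R]_(k, d) -> 'M[R]_d} :=
  [set f | multilinear f /\ alternate f].
Arguments alt_maps : clear implicits.

Section alt_change.
Context {R : realType} {k d : nat}.

Lemma alt_change_subproof (A B C : 'M[R]_d) (f : alt_maps R k d) :
  (fun V => B *m val f (V *m A) *m C) \in alt_maps R k d.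
Proof.
case: f => f /= /set_mem [mf af]; apply/mem_set; split.
  move=> i U V W b c hU hV hW.
  rewrite (mf i (U *m A) (V *m A) (W *m A) b c).
  - by rewrite mulmxDr mulmxDl -!scalemxAr -!scalemxAl.
  - by rewrite !row_mul hU mulmxDl !scalemxAl.
  - by rewrite !row'Esub -!mul_rowsub_mx -!row'Esub hV.
  - by rewrite !row'Esub -!mul_rowsub_mx -!row'Esub hW.
move=> i j V ij hV; rewrite (af i j) ?mulmx0 ?mul0mx//.
by rewrite !row_mul hV.
Qed.

Definition alt_change (A B C : 'M[R]_d) (f : alt_maps R k d) :
  alt_maps R k d :=
  exist (fun h => h \in alt_maps R k d) _ (alt_change_subproof A B C f).

End alt_change.

(* Total space of Lambda^k T^*M (x) End(E^g), for M = Omega: since the tangent *)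
(* spaces are all read as R^d, its underlying set is a product, and [act] and *)
(* [g] only matter for its topology below.                                    *)
Definition total_space {R : realType} {G : Type} {d : nat}
    {X : smoothManifoldType R d} (act : G -> X -> X) (Omega : set X) (k : nat)
    (g : G) : Type :=
  (Omega * alt_maps R k d)%type.

Section forms.
Context {R : realType} {n : nat} {G : lieGroupType R n}.
Context {d : nat} {X : smoothManifoldType R d}.
Variables (act : G -> X -> X) (Omega : set X) (k : nat).

Section coefficients.
Variable g : G.

(* Common domain of the charts of index x on M and g x on g M. *)
Definition triv_dom (x m : Omega) :=
  chart_dom (val x) (val m) /\
  chart_dom (act g (val x)) (act g (val m)).

(* Local trivialization of Lambda^k T^*M (x) End(E^g) over [triv_dom x], on   *)
(* the fibre over m: from coordinates in the charts of index m and g m to     *)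
(* coordinates in the charts of index x and g x.                              *)
Definition triv (x m : Omega) : alt_maps R k d -> alt_maps R k d :=
  alt_change (tcoord (val x) (val m) (val m))
    (tcoord (act g (val x)) (act g (val m)) (act g (val m)))
    (tcoord (act g (val m)) (act g (val x)) (act g (val m))).

Definition triv_inv (x m : Omega) : alt_maps R k d -> alt_maps R k d :=
  alt_change (tcoord (val m) (val x) (val m))
    (tcoord (act g (val m)) (act g (val x)) (act g (val m)))
    (tcoord (act g (val x)) (act g (val m)) (act g (val m))).

Local Notation total_space := (total_space act Omega k g).

(* A set is open if it is so in each local trivialization. *)
Definition total_open (U : set total_space) :=
  forall (x : Omega) (q : Omega * alt_maps R k d),
    triv_dom x q.1 -> U (q.1, triv_inv x q.1 q.2) ->
    \forall q' \near q, triv_dom x q'.1 -> U (q'.1, triv_inv x q'.1 q'.2).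

Lemma total_openT : total_open setT.
Proof. by move=> x q _ _; apply: (@filterE _ (nbhs q)). Qed.

Lemma total_openI : setI_closed total_open.
Proof.
move=> A B oA oB x q xq [Aq Bq].
by apply: (@filterS2 _ (nbhs q) (nbhs_filter q) _ _ _ _
  (oA x q xq Aq) (oB x q xq Bq)) => q' Aq' Bq' xq'; split; [exact: Aq'|exact: Bq'].
Qed.

Lemma total_open_bigU (I : Type) (f : I -> set total_space) :
  (forall i, total_open (f i)) -> total_open (\bigcup_i f i).
Proof.
move=> of_ x q xq [i _ fiq]; have := of_ i x q xq fiq.
by apply: (@filterS _ (nbhs q)) => q' fq' xq'; exists i => //; exact: fq'.
Qed.

HB.instance Definition _ := Choice.on total_space.
HB.instance Definition _ := isOpenTopological.Build total_space
  total_openT total_openI total_open_bigU.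

(* Arbitrary sections, seen as points of the product over m of copies of the  *)
(* total space; the smooth ones are selected by [is_form] below.              *)
Definition section_space : topologicalType :=
  initial_topology
    (fun s : Omega -> alt_maps R k d =>
       (fun m => (m, s m)) : prod_topology (fun _ : Omega => total_space)).

(* Omega^k(M; End(E^g)): the sections whose expression in the local           *)
(* trivialization of index x is smooth near x, for every x.                   *)
Definition is_form (s : section_space) :=
  forall (x : Omega) (V : 'M[R]_(k, d)),
    smooth_at (fun y => if insub (chart_inv (val x) y) is Some m
                        then val (triv x m (s m)) V else 0)
      (chart (val x) (val x)).

End coefficients.

(* g : Omega^k(M; End(E^h)) -> Omega^k(M; End(E^(g h))), extended to          *)
(* arbitrary sections: conjugation of the coefficients by dg at h m.          *)
Definition section_act (g h : G) (s : section_space h) :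
    section_space (g * h)%g :=
  fun m => let D := tangent_mx (act g) (act h (val m)) (act (g * h)%g (val m)) in
    alt_change 1%:M (invmx D) D (s m).

Section coproduct.
Context {Gamma : groupType} (rho : {multiplicative Gamma -> G}).

Lemma range_mul_subproof (a : Gamma) (h : range rho) :
  (rho a * val h)%g \in range rho.
Proof.
case: h => h /= /set_mem [b _ <-].
by apply/mem_set; exists (a * b)%g => //; rewrite gmulfM.
Qed.

Definition range_mul (a : Gamma) (h : range rho) : range rho :=
  
  exist (fun x => x \in range rho) _ (range_mul_subproof a h).

Definition coproduct : topologicalType :=
  {h : range rho & section_space (val h)}.

Definition coproduct_forms : set coproduct :=
  [set s | is_form (g := val (projT1 s)) (projT2 s)].

Definition coproduct_act (a : Gamma) (s : coproduct) : coproduct :=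
  existT (fun h : range rho => section_space (val h))
    (range_mul a (projT1 s))
    (section_act (rho a) (h := val (projT1 s)) (projT2 s)).

End coproduct.
End forms.

(* Main.v *)
Require Import Defs.
From HB Require Import structures.
From mathcomp Require Import all_boot all_order all_algebra.
From mathcomp Require Import all_classical all_reals all_analysis.
Import Order.TTheory GRing.Theory Num.Theory.
Import numFieldNormedType.Exports.

Set Implicit Arguments.
Unset Strict Implicit.
Unset Printing Implicit Defensive.

Local Open Scope classical_set_scope.
Local Open Scope ring_scope.

(* Omega^k(M; End(E^h)) is open in the disjoint union, so a compact set K of
   sections lives over a finite set J of elements of rho(Gamma).  If rho(a) K
   meets K then rho(a) lies in the finite set J J^-1, and rho has a finite
   kernel because the stabilizer in Gamma of a point of Omega is finite.

   That rho(Gamma) acts on the disjoint union is the chain rule.  Smoothness of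
   g s follows from that of s because, read in the charts of index h x and
   (g h) x, the action of g on the coefficients is conjugation by the Jacobian
   matrix of g along the smooth map h, whose inverse is the Jacobian matrix of
   g^-1 along g h. *)

(** * Matrix identities, finite fibres, and compactness in a disjoint union *)

Lemma invmx_mul (R : comUnitRingType) n (A B : 'M[R]_n) :
  A \in unitmx -> B \in unitmx -> invmx (A *m B) = invmx B *m invmx A.
Proof.
move=> uA uB; have uAB : A *m B \in unitmx by rewrite unitmx_mul uA.
by rewrite -[RHS](mulmxK uAB) -(mulmxA _ (invmx A)) mulKmx // mulVmx // mul1mx.
Qed.

(** Only the products on either side of [f] matter, so two nested conjugations can be exchanged by
    one chain-rule identity on the left and one on the right. *)
Lemma mulmx_conj (R : comPzRingType) n (A B A' B' f T C T' C' : 'M[R]_n) :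
  A *m B = A' *m B' -> T *m C = T' *m C' ->
  A *m (B *m f *m T) *m C = A' *m (B' *m f *m T') *m C'.
Proof. by move=> AB TC; rewrite !mulmxA AB -!mulmxA TC !mulmxA. Qed.

(** Each fibre of [rho] is empty or a translate of the kernel, and the preimage is a union of
    finitely many fibres. *)
Lemma finite_preimage_of_ker (Gamma G : groupType)
    (rho : {multiplicative Gamma -> G}) (F : set G) :
  finite_set [set a | rho a = 1%g] -> finite_set F ->
  finite_set (rho @^-1` F).
Proof.
move=> kerF finF.
have -> : rho @^-1` F = \bigcup_(h in F) (rho @^-1` [set h]).
  apply/seteqP; split=> [a Fa|a [h Fh ah]]; first by exists (rho a).
  by rewrite /preimage /= ah.
apply: bigcup_finite => // h _.
have [[b bh]|nb] := pselect (exists b, rho b = h); last first.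
  apply: (sub_finite_set _ (finite_set0 Gamma)) => a ah.
  by apply: nb; exists a.
apply: (sub_finite_set _ (finite_image (fun a => (b * a)%g) kerF)) => a ah.
exists (b^-1 * a)%g; last by rewrite mulVKg.
by apply: (mulgI (rho b)); rewrite -gmulfM mulVKg mulg1 bh.
Qed.

(* Otherwise the complements in K of finite unions of summands generate a
   proper filter, which clusters nowhere since each summand is open. *)
Lemma compact_sigT_finite (I : choiceType) (T : I -> topologicalType)
    (K : set {i & T i}) : compact K -> finite_set (@projT1 _ _ @` K).
Proof.
move=> cK; apply: contrapT => Kinf.
pose F : set_system {i & T i} := [set A |
  exists2 D : set I, finite_set D & K `&` [set p | ~ D (projT1 p)] `<=` A].
have FF : ProperFilter F.
  split.
    move=> [D finD KD]; apply: Kinf; apply: sub_finite_set finD.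
    by move=> _ [p Kp <-]; apply: contrapT => Dp; exact: (KD p).
  split.
  - by exists set0.
  - move=> A B [D finD KA] [E finE KB]; exists (D `|` E).
      by rewrite finite_setU.
    move=> p [Kp /not_orP[nD nE]]; split; [exact: KA|exact: KB].
  - by move=> A B AB [D finD KA]; exists D => // p /KA /AB.
have FK : F K by exists set0 => // p [].
have [[i t] [_ clp]] := cK F FF FK.
have [q [[_ qi]]] : (K `&` [set q | ~ [set i] (projT1 q)]) `&`
    (existT T i @` setT) !=set0.
  apply: clp; first by exists [set i].
  by apply: existT_nbhs; exact: filterT.
by move=> [u _ uq]; apply: qi; rewrite -uq.
Qed.

(** * Calculus of maps of class C^k between normed spaces *)

Section smooth_calculus.
Context {R : realType}.
Implicit Types U V W : normedModType R.

(** Agreement near [a] carries the first-order expansion of [f] over to [g], and a differential is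
    determined by such an expansion. *)
Lemma near_eq_diff V W (f g : V -> W) (a : V) :
  (\forall x \near a, f x = g x) -> differentiable f a ->
  differentiable g a /\ 'd g a = 'd f a :> (V -> W).
Proof.
move=> fg df; have [dfc dxf] := (diff_locallyP _ _).1 df.
have dxg : g \o shift a = cst (g a) + 'd f a +o_ (0 : V) id.
  apply/eqaddoP => e e0; have /eqaddoP/(_ e e0) := dxf.
  have fga : f a = g a by exact: nbhs_singleton fg.
  have fg0 : \forall h \near (0 : V), f (h + a) = g (h + a).
    by move: fg; rewrite (near_shift 0 a) /= subr0.
  apply: filterS2 fg0 => h; rewrite !fctE /= => fgh.
  by rewrite fgh fga.
have dga := diff_unique dfc dxg.
split; last exact: dga.
by apply/diff_locallyP; split; rewrite dga.
Qed.

(** Being C^k at [a] concerns all points near [a], and functions that agree near [a] also agree near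
    each point close to [a]. The induction then passes to the directional derivatives. *)
Lemma C_at_near_eq k V W (f g : V -> W) (a : V) :
  (\forall x \near a, f x = g x) -> C_at k f a -> C_at k g a.
Proof.
elim: k f g => [|k IH] f g fg /=.
  move=> fc; near=> x.
  have fgx : \forall y \near x, f y = g y.
    by near: x; exact: near_join fg.
  have fx : {for x, continuous f} by near: x.
  rewrite /prop_for /continuous_at -(nbhs_singleton fgx).
  exact: cvg_trans (near_eq_cvg fgx) fx.
move=> [df Cf]; split.
  near=> x; have fgx : \forall y \near x, f y = g y.
    by near: x; exact: near_join fg.
  have dfx : differentiable f x by near: x.
  by have [] := near_eq_diff fgx dfx.
move=> v; apply: IH (Cf v); near=> x.
have fgx : \forall y \near x, f y = g y.
  by near: x; exact: near_join fg.
have dfx : differentiable f x by near: x.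
by have [_ ->] := near_eq_diff fgx dfx.
Unshelve. all: by end_near. Qed.

Lemma C_atS k V W (f : V -> W) (a : V) : C_at k.+1 f a -> C_at k f a.
Proof.
elim: k f => [|k IH] f /= [df Cf].
  by apply: filterS df => x; exact: differentiable_continuous.
by split=> // v; exact: IH.
Qed.

Lemma C_at_cst k V W (w : W) (a : V) : C_at k (fun=> w) a.
Proof.
elim: k w => [|k IH] w /=; first by apply: filterE => x; exact: cst_continuous.
split=> [|v]; first by apply: filterE => x; exact: differentiable_cst.
apply: C_at_near_eq (IH 0); apply: filterE => x.
by rewrite -/(cst w) (diff_cst w).
Qed.

Lemma C_at_id k V (a : V) : C_at k id a.
Proof.
case: k => [|k] /=; first by apply: filterE => y; exact: cvg_id.
split=> [|v]; first by apply: filterE => y; have [] := is_diff_id y.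
apply: C_at_near_eq (C_at_cst k v a); apply: filterE => y.
by have [_ ->] := is_diff_id y.
Qed.

Lemma C_at_linear k U V W (L : {linear V -> W}) (f : U -> V) (a : U) :
  continuous L -> C_at k f a -> C_at k (L \o f) a.
Proof.
move=> cL; elim: k f => [|k IH] f /=.
  by apply: filterS => x fx; apply: continuous_comp => //; exact: cL.
move=> [df Cf]; have dL x : differentiable L x by exact: linear_differentiable.
split=> [|v].
  by apply: filterS df => x dfx; exact: differentiable_comp.
apply: C_at_near_eq (IH _ (Cf v)); apply: filterS df => x dfx.
by rewrite diff_comp //= (diff_lin _ cL).
Qed.

Lemma C_atD k V W (f g : V -> W) (a : V) :
  C_at k f a -> C_at k g a -> C_at k (fun x => f x + g x) a.
Proof.
elim: k f g => [|k IH] f g /=.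
  by apply: filterS2 => x; exact: continuousD.
move=> [df Cf] [dg Cg]; split=> [|v].
  by apply: filterS2 df dg => x; exact: differentiableD.
apply: C_at_near_eq (IH _ _ (Cf v) (Cg v)); apply: filterS2 df dg => x dfx dgx.
exact: esym (congr1 (@^~ v) (diffD dfx dgx)).
Qed.

Lemma C_at_sum k V W (I : Type) (r : seq I) (f : I -> V -> W) (a : V) :
  (forall i, C_at k (f i) a) -> C_at k (fun x => \sum_(i <- r) f i x) a.
Proof.
move=> Cf; elim: r => [|i r IH].
  by apply: C_at_near_eq (C_at_cst k 0 a); apply: filterE => x; rewrite big_nil.
apply: C_at_near_eq (C_atD (Cf i) IH).
by apply: filterE => x; rewrite big_cons.
Qed.

(** By the Leibniz rule the derivative is a sum of two terms of the same shape, each with one factor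
    differentiated, so induction on the order applies. *)
Lemma C_at_bilinear k U V V' W (B : {bilinear V -> V' -> W})
    (f : U -> V) (g : U -> V') (a : U) :
  continuous (fun q : V * V' => B q.1 q.2) ->
  C_at k f a -> C_at k g a -> C_at k (fun x => B (f x) (g x)) a.
Proof.
move=> cB; elim: k f g => [|k IH] f g.
  move=> /=; apply: filterS2 => x fx gx.
  apply: (@continuous_comp _ _ _ (fun x => (f x, g x)) (fun q => B q.1 q.2)).
    exact: cvg_pair.
  exact: cB.
(* The factor left undifferentiated by the Leibniz rule must be known to be C^k, hence the drop from
   order k + 1. *)
move=> Cf Cg; have Cf' := C_atS Cf; have Cg' := C_atS Cg.
case: Cf => df Cf; case: Cg => dg Cg.
have dB x : differentiable f x -> differentiable g x ->
    is_diff x (fun y => B (f y) (g y))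
      (fun v => B (f x) ('d g x v) + B ('d f x v) (g x)).
  move=> dfx dgx.
  rewrite -[X in is_diff_def _ X]/
    ((fun q => B q.1 q.2) \o (fun y => (f y, g y))).
  have dp := differentiable_pair dfx dgx.
  apply: DiffDef.
    by apply: differentiable_comp dp _; exact: differentiable_bilin.
  rewrite diff_comp //; last exact: differentiable_bilin.
  by rewrite diff_bilin // diff_pair.
split=> [|v].
  by apply: filterS2 df dg => x dfx dgx; have [] := dB x dfx dgx.
apply: C_at_near_eq (C_atD (IH _ _ Cf' (Cg v)) (IH _ _ (Cf v) Cg')).
by apply: filterS2 df dg => x dfx dgx; have [_ ->] := dB x dfx dgx.
Qed.

Lemma C_at_scale k V W (u : V -> R) (f : V -> W) (a : V) :
  C_at k u a -> C_at k f a -> C_at k (fun x => u x *: f x) a.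
Proof.
have bil : bilinear_for (GRing.Scale.Law.clone _ _ *:%R _)
    (GRing.Scale.Law.clone _ _ *:%R _) (@GRing.scale R W).
  split=> [w|b] c x y /=; first by rewrite scalerDl scalerA.
  by rewrite scalerDr !scalerA mulrC.
pose bM := bilinear_isBilinear.Build R R W W _ _ (@GRing.scale R W) bil.
pose B : {bilinear R -> W -> W} := HB.pack (@GRing.scale R W) bM.
move=> Cu Cf.
apply: (@C_at_bilinear k V R W W B u f) => //.
exact: (@scale_continuous R W).
Qed.

Lemma continuous_sum (T : topologicalType) W (I : Type) (r : seq I)
    (f : I -> T -> W) (x : T) :
  (forall i, {for x, continuous (f i)}) ->
  {for x, continuous (fun y => \sum_(i <- r) f i y)}.
Proof.
move=> fx; rewrite /prop_for; elim: r => [|i r IH].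
  by under eq_fun do rewrite big_nil; exact: cst_continuous.
under eq_fun do rewrite big_cons.
by apply: continuousD => //; exact: fx.
Qed.

(** Expanding in elementary matrices writes [L] as a finite sum of coordinates times fixed
    vectors. *)
Lemma linear_mx_continuous m n W (L : {linear 'M[R]_(m, n) -> W}) :
  continuous L.
Proof.
have -> : L = (fun A => \sum_i \sum_j A i j *: L (delta_mx i j)) :> (_ -> _).
  apply/funext => A; rewrite {1}(matrix_sum_delta A) linear_sum.
  apply: eq_bigr => i _; rewrite linear_sum; apply: eq_bigr => j _.
  exact: linearZ.
move=> A; apply: continuous_sum => i; apply: continuous_sum => j.
by apply: continuousZr_tmp; exact: coord_continuous.
Qed.

Lemma mulmx_continuous m n p :
  continuous (fun q : 'M[R]_(m, n) * 'M[R]_(n, p) => q.1 *m q.2).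
Proof.
have -> : (fun q : 'M[R]_(m, n) * 'M[R]_(n, p) => q.1 *m q.2) =
    (fun q => \sum_i \sum_j (\sum_l q.1 i l * q.2 l j) *: delta_mx i j).
  apply/funext => q; rewrite {1}(matrix_sum_delta (q.1 *m q.2)).
  by apply: eq_bigr => i _; apply: eq_bigr => j _; rewrite mxE.
move=> q; apply: continuous_sum => i; apply: continuous_sum => j.
apply: continuousZr_tmp; apply: continuous_sum => l.
apply: continuousM.
  apply: (@continuous_comp _ _ _ fst (fun A : 'M[R]_(m, n) => A i l)).
    exact: cvg_fst.
  exact: coord_continuous.
apply: (@continuous_comp _ _ _ snd (fun A : 'M[R]_(n, p) => A l j)).
  exact: cvg_snd.
exact: coord_continuous.
Qed.

Lemma C_at_mulmx k V m n p (f : V -> 'M[R]_(m, n)) (g : V -> 'M[R]_(n, p)) a :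
  C_at k f a -> C_at k g a -> C_at k (fun x => f x *m g x) a.
Proof.
by apply: (C_at_bilinear (B := mulmx)); exact: mulmx_continuous.
Qed.

(** In coordinates the chain rule expresses the derivative as a sum of the coordinates of ['d f x v]
    times the partial derivatives of [g] at [f x]. These are again composites with [f], so the
    induction fixes [f] and varies [g]. *)
Lemma C_at_comp k V m W (f : V -> 'rV[R]_m) (g : 'rV[R]_m -> W) (a : V) :
  {for a, continuous f} ->
  C_at k f a -> C_at k g (f a) -> C_at k (g \o f) a.
Proof.
move=> fa; elim: k g => [|k IH] g Cf Cg.
  have fg := fa _ Cg.
  by move: Cf fg => /=; apply: filterS2 => x; exact: continuous_comp.
have Cf' := C_atS Cf; case: Cf => df Cf; case: Cg => dg Cg.
have {dg}dg := fa _ dg.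
split=> [|v].
  by apply: filterS2 df dg => x; exact: differentiable_comp.
have cf' i : C_at k (fun x => 'd f x v 0 i) a.
  have cL : continuous (fun w : 'rV[R]_m => w 0 i : R).
    exact: coord_continuous.
  have Ll : linear (fun w : 'rV[R]_m => w 0 i : R).
    by move=> c x y; rewrite !mxE.
  pose LM := GRing.isLinear.Build _ _ _ _ _ Ll.
  pose L : {linear 'rV[R]_m -> R} := HB.pack (fun w : 'rV[R]_m => w 0 i : R) LM.
  exact: (@C_at_linear k V _ _ L (fun x => 'd f x v) a cL (Cf v)).
apply: (@C_at_near_eq _ _ _
  (fun x => \sum_i 'd f x v 0 i *: 'd g (f x) (delta_mx 0 i))); last first.
  by apply: C_at_sum => i; apply: C_at_scale (cf' i) (IH _ Cf' (Cg _)).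
apply: filterS2 df dg => x dfx dgx.
rewrite (diff_comp dfx dgx) -[RHS]/('d g (f x) ('d f x v)).
rewrite (congr1 ('d g (f x)) (row_sum_delta ('d f x v))) linear_sum.
by apply: eq_bigr => i _; rewrite linearZ.
Qed.

(** The rows of the Jacobian are the partial derivatives of [g], placed in position by constant
    column matrices. *)
Lemma C_at_jacobian k V m n (f : V -> 'rV[R]_m) (g : 'rV[R]_m -> 'rV[R]_n) a :
  {for a, continuous f} ->
  smooth_at f a -> smooth_at g (f a) -> C_at k (fun x => 'J g (f x)) a.
Proof.
move=> fa sf sg.
apply: (@C_at_near_eq _ _ _
  (fun x => \sum_i delta_mx i 0 *m 'd g (f x) (delta_mx 0 i))).
  apply: filterE => x; apply/row_matrixP => i.
  rewrite linear_sum (bigD1 i) //= big1 ?addr0 => [|j ji].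
    (* The remaining elementary matrix is 1 by 1, hence the identity. *)
    rewrite row_mul rowE mul_delta_mx [delta_mx 0 0](_ : _ = 1%:M) ?mul1mx.
      by rewrite rowE mul_rV_lin1.
    by apply/matrixP => u v; rewrite !mxE !ord1.
  rewrite row_mul rowE mul_delta_mx_0 ?mul0mx //.
  by rewrite eq_sym.
apply: C_at_sum => i; apply: C_at_mulmx; first exact: C_at_cst.
(* One order of smoothness of [g] is spent on taking its partial derivatives. *)
have [_ Cg] := sg k.+1.
exact: C_at_comp (sf k) (Cg (delta_mx 0 i)).
Qed.

Lemma smooth_differentiable V W (f : V -> W) a :
  smooth_at f a -> differentiable f a.
Proof. by move=> /(_ 1)[/nbhs_singleton]. Qed.

End smooth_calculus.

(** * Jacobian matrices in arbitrary charts and the chain rule on manifolds *)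

Section chart_jacobian.
Context {R : realType}.

(* [tcoord x y z] and [tangent_mx f x y] are, by conversion, the cases [f = id]
   and [a = x] of this. *)
Definition chart_jacobian m n (M : smoothManifoldType R m)
    (N : smoothManifoldType R n) (f : M -> N) (a : M) (b : N) (x : M) :
    'M[R]_(m, n) :=
  'J (chart b \o f \o chart_inv a) (chart a x).

(** [smooth_map] looks only at the charts of index [x] and [f x]. Every chart around these points is
    allowed here, because the chain rule will be used between charts with other indices. *)
Definition differentiable_map m n (M : smoothManifoldType R m)
    (N : smoothManifoldType R n) (f : M -> N) (x : M) :=
  {for x, continuous f} /\
  forall a b, chart_dom a x -> chart_dom b (f x) ->
    differentiable (chart b \o f \o chart_inv a) (chart a x).

Lemma near_chart_inv m (M : smoothManifoldType R m) (a x : M) (P : set M) :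
  chart_dom a x -> nbhs x P -> \forall y \near chart a x, P (chart_inv a y).
Proof.
move=> ax Px; have := chart_inv_continuous a x ax.
by rewrite /prop_for /continuous_at chartK // => /(_ _ Px).
Qed.

Lemma near_chart_invK m (M : smoothManifoldType R m) (a x : M) :
  chart_dom a x -> \forall y \near chart a x, chart a (chart_inv a y) = y.
Proof.
move=> ax; have oU := @chart_image_open _ _ M a.
have : nbhs (chart a x) (chart a @` chart_dom a).
  by apply: open_nbhs_nbhs; split => //; exists x.
by apply: filterS => _ [z az <-]; rewrite chartK.
Qed.

Lemma chart_dom_nbhs m (M : smoothManifoldType R m) (a x : M) :
  chart_dom a x -> nbhs x (chart_dom a).
Proof.
by move=> ax; apply: open_nbhs_nbhs; split => //; exact: chart_dom_open.
Qed.

Lemma row_jacobian m n (f : 'rV[R]_m -> 'rV[R]_n) a i :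
  row i ('J f a) = 'd f a (delta_mx 0 i).
Proof. by rewrite rowE /jacobian mul_rV_lin1. Qed.

Lemma jacobian_near_eq m n (f g : 'rV[R]_m -> 'rV[R]_n) a :
  (\forall x \near a, f x = g x) -> differentiable f a -> 'J f a = 'J g a.
Proof.
move=> fg df; have [_ e] := near_eq_diff fg df.
apply/row_matrixP => i.
apply: etrans (row_jacobian f a i) (etrans _ (esym (row_jacobian g a i))).
exact: esym (congr1 (@^~ _) e).
Qed.

Lemma jacobian_comp m n p (f : 'rV[R]_m -> 'rV[R]_n) (g : 'rV[R]_n -> 'rV[R]_p)
    a : differentiable f a -> differentiable g (f a) ->
  'J (g \o f) a = 'J f a *m 'J g (f a).
Proof.
move=> df dg; apply/row_matrixP => i.
apply: etrans (row_jacobian (g \o f) a i) _.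
rewrite row_mul (row_jacobian f) /jacobian mul_rV_lin1.
by have := congr1 (@^~ (delta_mx 0 i)) (diff_comp df dg).
Qed.

(** Near the point the middle chart [b] cancels against its inverse. Differentiability is asked only
    in the given charts, since independence of the charts is itself derived from this lemma. *)
Lemma chart_jacobian_comp_at m n p (M : smoothManifoldType R m)
    (N : smoothManifoldType R n) (L : smoothManifoldType R p)
    (f : M -> N) (g : N -> L) a b c x :
  {for x, continuous f} -> chart_dom a x -> chart_dom b (f x) ->
  differentiable (chart b \o f \o chart_inv a) (chart a x) ->
  differentiable (chart c \o g \o chart_inv b) (chart b (f x)) ->
  differentiable (chart c \o (g \o f) \o chart_inv a) (chart a x) /\
  chart_jacobian (g \o f) a c x =
    chart_jacobian f a b x *m chart_jacobian g b c (f x).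
Proof.
move=> fx ax bfx df dg.
pose F := chart b \o f \o chart_inv a.
pose H := chart c \o g \o chart_inv b.
pose K := chart c \o (g \o f) \o chart_inv a.
have Fx : F (chart a x) = chart b (f x) by rewrite /F /= chartK.
have HFK : \forall y \near chart a x, (H \o F) y = K y.
  have := near_chart_inv ax (fx _ (chart_dom_nbhs bfx)).
  by apply: filterS => y by_; rewrite /H /F /K /= chartK.
rewrite -/F in df; rewrite -/H -Fx in dg.
have dHF : differentiable (H \o F) (chart a x) by exact: differentiable_comp.
have [dK _] := near_eq_diff HFK dHF; split => //.
rewrite /chart_jacobian -/F -/H -/K -Fx.
exact: etrans (esym (jacobian_near_eq HFK dHF)) (jacobian_comp df dg).
Qed.

Lemma chart_change_differentiable m (M : smoothManifoldType R m) (a b x : M) :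
  chart_dom a x -> chart_dom b x ->
  differentiable (chart b \o id \o chart_inv a) (chart a x).
Proof.
by move=> ax bx; exact: smooth_differentiable (chart_smooth a b x ax bx).
Qed.

(** Composition with smooth transition maps replaces the charts of index [x] and [f x] by arbitrary
    ones: first the source chart, then the target chart. *)
Lemma smooth_map_differentiable m n (M : smoothManifoldType R m)
    (N : smoothManifoldType R n) (f : M -> N) x :
  smooth_map f -> differentiable_map f x.
Proof.
move=> /(_ x)[fx /smooth_differentiable df]; split=> // a b ax bfx.
have xx := chart_dom_self x; have fxfx := chart_dom_self (f x).
have cid : {for x, continuous (@id M)} by exact: cvg_id.
have [d1 _] := @chart_jacobian_comp_at _ _ _ M M N id f a x (f x) x
  cid ax xx (chart_change_differentiable ax xx) df.
have [] // := @chart_jacobian_comp_at _ _ _ M N N f id a (f x) b x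
  fx ax fxfx d1 (chart_change_differentiable fxfx bfx).
Qed.

Lemma id_differentiable m (M : smoothManifoldType R m) (x : M) :
  differentiable_map (@id M) x.
Proof.
split; first exact: cvg_id.
by move=> a b; exact: chart_change_differentiable.
Qed.

Lemma chart_jacobian_comp m n p (M : smoothManifoldType R m)
    (N : smoothManifoldType R n) (L : smoothManifoldType R p)
    (f : M -> N) (g : N -> L) a b c x :
  differentiable_map f x -> differentiable_map g (f x) ->
  chart_dom a x -> chart_dom b (f x) -> chart_dom c (g (f x)) ->
  chart_jacobian (g \o f) a c x =
    chart_jacobian f a b x *m chart_jacobian g b c (f x).
Proof.
move=> [fx df] [_ dg] ax bfx cgfx.
have [] := chart_jacobian_comp_at fx ax bfx (df _ _ ax bfx) (dg _ _ bfx cgfx).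
by [].
Qed.

Lemma chart_jacobian_id m (M : smoothManifoldType R m) (a x : M) :
  chart_dom a x -> chart_jacobian id a a x = 1%:M.
Proof.
move=> ax.
have idE : \forall y \near chart a x, id y = (chart a \o id \o chart_inv a) y.
  by apply: filterS (near_chart_invK ax) => y /= ->.
have [did e] : is_diff (chart a x) (@id 'rV[R]_m) id by exact: is_diff_id.
rewrite /chart_jacobian -(jacobian_near_eq idE did).
by apply/row_matrixP => i; rewrite (row_jacobian id) e rowE mulmx1.
Qed.

(** The charts of index [h x] and [f (h x)] stay fixed while the point moves. With charts indexed by
    the moving point, as in [tangent_mx], no regularity could be expected. *)
Lemma chart_jacobian_smooth m p q (L : smoothManifoldType R m)
    (M : smoothManifoldType R p) (N : smoothManifoldType R q)
    (h : L -> M) (f : M -> N) (x : L) k :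
  smooth_map h -> smooth_map f ->
  C_at k (fun y => chart_jacobian f (h x) (f (h x)) (h (chart_inv x y)))
    (chart x x).
Proof.
move=> /(_ x)[_ sh] /(_ (h x))[_ sf].
have ch := differentiable_continuous (smooth_differentiable sh).
apply: (@C_at_jacobian R k _ _ _ _
  (chart (f (h x)) \o f \o chart_inv (h x)) _ ch sh).
by rewrite /= chartK //; exact: chart_dom_self.
Qed.

(** The chain rule for [f' \o f = id] gives a one-sided inverse, which suffices for square
    matrices. *)
Lemma invmx_chart_jacobian m (M N : smoothManifoldType R m)
    (f : M -> N) (f' : N -> M) a b x :
  cancel f f' -> smooth_map f -> smooth_map f' ->
  chart_dom a x -> chart_dom b (f x) ->
  chart_jacobian f a b x \in unitmx /\
  invmx (chart_jacobian f a b x) = chart_jacobian f' b a (f x).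
Proof.
move=> fK sf sf' ax bfx.
have e : chart_jacobian f a b x *m chart_jacobian f' b a (f x) = 1%:M.
  rewrite -chart_jacobian_comp //; last by rewrite fK.
  - rewrite (_ : f' \o f = id); first exact: chart_jacobian_id.
    by apply/funext => y /=; rewrite fK.
  - exact: smooth_map_differentiable.
  - exact: smooth_map_differentiable.
have [u _] := mulmx1_unit e; split => //.
by rewrite -[LHS]mulmx1 -e mulKmx.
Qed.

End chart_jacobian.

(** * The action on sections: preservation of smoothness and the action laws *)

Section forms_action.
Context {R : realType} {n : nat} {G : lieGroupType R n}.
Context {d : nat} {X : smoothManifoldType R d}.
Context (act : G -> X -> X) (Omega : set X) (k : nat).
Hypothesis sact : smooth_map2 act.
Hypothesis act1 : forall x, act 1%g x = x.
Hypothesis actM : forall g h x, act (g * h)%g x = act g (act h x).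

(** In the product chart, fixing the first argument means precomposing with the affine map [F] that
    prefixes the coordinates of [g]. *)
Lemma act_smooth (g : G) : smooth_map (act g).
Proof.
move=> x; have [ca sa] := sact g x; split.
  apply: (@continuous_comp _ _ _ (fun y => (g, y))
    (fun q => act q.1 q.2)) => //.
  by apply: cvg_pair => //; exact: cvg_cst.
move=> j.
pose c := chart g g.
pose F (y : 'rV[R]_d) : 'rV[R]_(n + d) := row_mx c y.
have row_mx_lin : linear (fun y : 'rV[R]_d => row_mx 0 y : 'rV[R]_(n + d)).
  by move=> b y z; rewrite scale_row_mx add_row_mx scaler0 addr0.
pose LM := GRing.isLinear.Build _ _ _ _ _ row_mx_lin.
pose L : {linear 'rV[R]_d -> 'rV[R]_(n + d)} :=
  HB.pack (fun y : 'rV[R]_d => row_mx 0 y : 'rV[R]_(n + d)) LM.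
have cL : continuous L by exact: linear_mx_continuous.
have sid := C_at_id j (chart x x).
have FE y : row_mx c 0 + L y = F y.
  by rewrite /F /L /= add_row_mx addr0 add0r.
have cF : {for chart x x, continuous F}.
  rewrite (_ : F = (fun y => row_mx c 0 + L y)); last by apply/funext => y.
  by apply: continuousD; [exact: cst_continuous|exact: cL].
have sF : C_at j F (chart x x).
  apply: C_at_near_eq (C_atD (C_at_cst j (row_mx c 0) _) (C_at_linear cL sid)).
  by apply: filterE => y; exact: FE.
apply: C_at_near_eq (C_at_comp cF sF (sa j)); apply: filterE => y.
by rewrite /= row_mxKl row_mxKr chartK //; exact: chart_dom_self.
Qed.

Lemma trivE (g : G) (x m : Omega) (f : alt_maps R k d) (V : 'M[R]_(k, d)) :
  val (triv act g x m f) V =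
  chart_jacobian id (act g (val x)) (act g (val m)) (act g (val m)) *m
  val f (V *m tcoord (val x) (val m) (val m)) *m
  chart_jacobian id (act g (val m)) (act g (val x)) (act g (val m)).
Proof. by []. Qed.

Lemma section_actE (g h : G) (s : section_space act Omega k h) (m : Omega)
    (V : 'M[R]_(k, d)) :
  let D := chart_jacobian (act g) (act h (val m)) (act (g * h)%g (val m))
    (act h (val m)) in
  val (section_act g s m) V = invmx D *m val (s m) V *m D.
Proof.
move=> D.
have -> : val (section_act g s m) V =
  invmx D *m val (s m) (V *m 1%:M) *m D by [].
by rewrite mulmx1.
Qed.

(** The charts that move with [m] cancel by the chain rule. What remains is a conjugation by
    Jacobians in the fixed charts of index [h x] and [(g h) x]. *)
Lemma triv_section_act (g h : G) (s : section_space act Omega k h)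
    (x m : Omega) (V : 'M[R]_(k, d)) :
  chart_dom (act h (val x)) (act h (val m)) ->
  chart_dom (act (g * h)%g (val x)) (act (g * h)%g (val m)) ->
  val (triv act (g * h)%g x m (section_act g s m)) V =
  chart_jacobian (act g^-1%g) (act (g * h)%g (val x)) (act h (val x))
    (act (g * h)%g (val m)) *m val (triv act h x m (s m)) V *m
  chart_jacobian (act g) (act h (val x)) (act (g * h)%g (val x))
    (act h (val m)).
Proof.
move=> hxm ghxm.
have gK : cancel (act g) (act g^-1%g).
  by move=> y; rewrite -actM mulVg act1.
have sm a := act_smooth a.
have dm a z : differentiable_map (act a) z by exact: smooth_map_differentiable.
have id1 z : differentiable_map (@id X) z by exact: id_differentiable.
have self (z : X) : chart_dom z z by exact: chart_dom_self.
apply: etrans (trivE _ _ _ _ _) _; apply: esym.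
apply: etrans (congr1 (fun W => _ *m W *m _) (trivE _ _ _ _ _)) _.
apply: esym.
apply: etrans (congr1 (fun W => _ *m W *m _) (section_actE _ _ _ _)) _.
have ghm : act (g * h)%g (val m) = act g (act h (val m)) by exact: actM.
(* The points become variables so that [(g h) m] can be replaced everywhere by [g (h m)]. *)
move: (act (g * h)%g (val m)) (act (g * h)%g (val x)) ghm ghxm.
move=> ghm ghx ghmE ghxm.
move: (act h (val x)) (act h (val m)) hxm ghmE => hx hm hxm ghmE.
subst ghm.
have [_ iE] := invmx_chart_jacobian gK (sm g) (sm g^-1%g)
  (self hm) (self (act g hm)).
move: (invmx _) iE => I iE; subst I.
move: (val (s m) _) => f.
(* Both sides are the Jacobian of [g] at [hm] from the chart [hm] to the chart [ghx], factored
   through two different intermediate charts. *)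
have e1 : chart_jacobian (act g) hm (act g hm) hm *m
    chart_jacobian id (act g hm) ghx (act g hm) =
    chart_jacobian id hm hx hm *m chart_jacobian (act g) hx ghx hm.
  apply: etrans (esym (chart_jacobian_comp _ _ _ _ _)) _ => //.
  by apply: (@chart_jacobian_comp _ _ _ _ _ _ _ id (act g)).
(* Likewise for the inverse of [g] at [g hm], from the chart [ghx] to the chart [hm]. *)
have e2 : chart_jacobian id ghx (act g hm) (act g hm) *m
    chart_jacobian (act g^-1%g) (act g hm) hm (act g hm) =
    chart_jacobian (act g^-1%g) ghx hx (act g hm) *m
    chart_jacobian id hx hm hm.
  have := @chart_jacobian_comp _ _ _ _ _ _ _ (act g^-1%g) id
    ghx hx hm (act g hm).
  rewrite gK => /(_ (dm _ _) (id1 _) ghxm hxm (self _)); apply: etrans.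
  have := @chart_jacobian_comp _ _ _ _ _ _ _ id (act g^-1%g)
    ghx (act g hm) hm (act g hm).
  rewrite gK => /(_ (id1 _) (dm _ _) ghxm (self _) (self _)).
  exact: esym.
exact: mulmx_conj e2 e1.
Qed.

Lemma section_act_is_form (g h : G) (s : section_space act Omega k h) :
  is_form s -> is_form (section_act g s).
Proof.
move=> sform x V j.
have sm a := act_smooth a.
have self := chart_dom_self (val x).
(* By continuity the image of a point near [x] stays in the fixed chart around the image of [x], as
   [triv_section_act] demands for [h] and [g h]. *)
have nd a : \forall y \near chart (val x) (val x),
    chart_dom (act a (val x)) (act a (chart_inv (val x) y)).
  pose P z := chart_dom (act a (val x)) (act a z).
  apply: (near_chart_inv (P := P) self).
  have [ca _] := sm a (val x).
  exact: ca _ (chart_dom_nbhs (chart_dom_self _)).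
pose F y := if insub (chart_inv (val x) y) is Some m
  then val (triv act h x m (s m)) V else 0.
have sF : C_at j F (chart (val x) (val x)) by exact: sform.
have sD := chart_jacobian_smooth (val x) j (sm h) (sm g).
have sD' := chart_jacobian_smooth (val x) j (sm (g * h)%g) (sm g^-1%g).
have E : act g^-1%g (act (g * h)%g (val x)) = act h (val x).
  by rewrite -actM mulKg.
rewrite E in sD'; rewrite -actM in sD.
apply: C_at_near_eq (C_at_mulmx (C_at_mulmx sD' sF) sD).
apply: filterS2 (nd h) (nd (g * h)%g) => y hy ghy; rewrite /F.
(* Off [Omega] both local expressions take the default value 0, which conjugation preserves. *)
case: insubP => [m _ mE|_]; last by rewrite mulmx0 mul0mx.
rewrite -mE in hy ghy *.
exact: esym (triv_section_act s V hy ghy).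
Qed.

Lemma section_act1 (h : G) (s : section_space act Omega k h) (m : Omega) :
  section_act 1%g s m = s m.
Proof.
apply: val_inj; apply/funext => V.
apply: etrans (section_actE _ _ _ _) _; rewrite mul1g.
rewrite (_ : act 1%g = id); last by apply/funext.
rewrite (chart_jacobian_id (chart_dom_self (act h (val m)))).
by rewrite invmx1 mul1mx mulmx1.
Qed.

(** This is the chain rule for [act a \o act b], with the order of factors reversed in the inverse
    matrix. *)
Lemma section_actM (a b h : G) (s : section_space act Omega k h) (m : Omega) :
  section_act (a * b)%g s m = section_act a (section_act b s) m.
Proof.
apply: val_inj; apply/funext => V.
have sm c := act_smooth c.
have cK c : cancel (act c) (act c^-1%g).
  by move=> y; rewrite -actM mulVg act1.
have dm c z : differentiable_map (act c) z by exact: smooth_map_differentiable.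
have self (z : X) : chart_dom z z by exact: chart_dom_self.
apply: etrans (section_actE _ _ _ _) _; apply: esym.
apply: etrans (section_actE _ _ _ _) _.
apply: etrans (congr1 (fun W => _ *m W *m _) (section_actE _ _ _ _)) _.
have e1 : act (a * (b * h))%g (val m) = act a (act b (act h (val m))).
  by rewrite !actM.
have e2 : act (b * h)%g (val m) = act b (act h (val m)) by rewrite actM.
have e3 : act (a * b * h)%g (val m) = act a (act b (act h (val m))).
  by rewrite !actM.
have e4 : act (a * b)%g = act a \o act b by apply/funext => z; rewrite actM.
rewrite e1 e2 e3 e4.
move: (act h (val m)) => x; move: (val (s m) V) => f.
have [ub _] := invmx_chart_jacobian (cK b) (sm b) (sm b^-1%g)
  (self x) (self (act b x)).
have [ua _] := invmx_chart_jacobian (cK a) (sm a) (sm a^-1%g)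
  (self (act b x)) (self (act a (act b x))).
have := chart_jacobian_comp (dm b x) (dm a (act b x))
  (self x) (self (act b x)) (self (act a (act b x))).
move: ub ua; move: (chart_jacobian _ _ _ _) (chart_jacobian _ _ _ _)
  (chart_jacobian _ _ _ _) => A B C ub ua ->.
by rewrite invmx_mul // !mulmxA.
Qed.

(** Sections over any index take values in the same [alt_maps R k d], so they can be compared
    pointwise before their indices are identified, without transport. *)
Lemma coproduct_eq (Gamma : groupType) (rho : {multiplicative Gamma -> G})
    (s t : coproduct act Omega k rho) :
  val (projT1 s) = val (projT1 t) ->
  (forall m : Omega, projT2 s m = projT2 t m) -> s = t.
Proof.
case: s t => [h s] [h' t] /= /val_inj e; subst h' => st.
by congr existT; apply/funext.
Qed.

End forms_action.

(** * Proper discontinuity on the disjoint union *)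

Theorem proposition3p2
  (R : realType)
  (Gamma : groupType) (S : seq Gamma) (hyp_Gamma : @word_hyperbolic R Gamma S)
  (hGamma : @flow_space R Gamma S)
  (n : nat) (G : lieGroupType R n) (ss_G : semisimple G)
  (Pp Pm : set G) (opp_P : opposite_parabolics Pp Pm)
  (p : nat) (Fp : smoothManifoldType R p) (actp : G -> Fp -> Fp) (op : Fp)
  (hom_Fp : homogeneous_space Pp actp op)
  (q : nat) (Fm : smoothManifoldType R q) (actm : G -> Fm -> Fm) (om : Fm)
  (hom_Fm : homogeneous_space Pm actm om)
  (rho : {multiplicative Gamma -> G})
  (anosov_rho : anosov hGamma rho actp actm)
  (H : set G) (H_type : parabolic H \/ symmetric_subgroup H)
  (d : nat) (X : smoothManifoldType R d) (act : G -> X -> X) (o : X)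
  (hom_X : homogeneous_space H act o)
  (Omega : set X)
  (dod : domain_of_discontinuity (fun a : Gamma => act (rho a)) Omega)
  (k : nat) (le_k_d : (k <= d)%N) :
  acts_properly_discontinuously
    (@coproduct_act _ _ _ _ _ act Omega k _ rho)
    (@coproduct_forms _ _ _ _ _ act Omega k _ rho).
Proof.
have [sact act1 actM _ _] := hom_X.
have [[x Ox] _ [_ _ _ pdOmega]] := dod.
have rho1 : rho 1%g = 1%g.
  by apply: (mulgI (rho 1%g)); rewrite -gmulfM !mulg1.
split.
- move=> a s fs; exact: section_act_is_form.
- move=> s _; apply: coproduct_eq => [|m] /=; rewrite rho1 ?mul1g //.
  exact: section_act1.
- move=> a b s _; apply: coproduct_eq => [|m] /=; rewrite gmulfM ?mulgA //.
  exact: section_actM.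
move=> K _ cK.
(* [J] is the finite set of elements of [G] that index the summands met by [K]. *)
have finJ := finite_image (fun h : range rho => val h) (compact_sigT_finite cK).
set J := (_ @` _) in finJ.
(* The kernel fixes the point [x] of [Omega], so proper discontinuity is applied to the compact set
   [[set x]]. *)
have kerF : finite_set [set a | rho a = 1%g].
  apply: sub_finite_set (pdOmega [set x] _ (@compact_set1 _ x)).
    by move=> a a1; exists x; split => //; exists x => //; rewrite a1 act1.
  by move=> _ ->.
have finJJ : finite_set [set (u * v^-1)%g | u in J & v in J].
  exact: finite_image2.
apply: sub_finite_set (finite_preimage_of_ker kerF finJJ).
move=> a [t [[s Ks st] Kt]] /=.
(* If [t] is the image of [s] under [a], its index is [rho a] times that of [s]; hence [rho a] is
   the index of [t] times the inverse of the index of [s]. *)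
exists (val (projT1 t)); first by exists (projT1 t) => //; exists t.
exists (val (projT1 s)); first by exists (projT1 s) => //; exists s.
by rewrite -st /= mulgK.
Qed.
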